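(* Fix any integer $d\ge 2$. For any $f\in C([0,1]^d)$ and any $\epsilon>0$, there exists a Kolmogorov-Lipschitz (KL) continuous function $K_\epsilon$, dependent on $\epsilon$, such that $$\|f-K_\epsilon\|_\infty\le \epsilon .$$ Furthermore, the Kolmogorov-Lipschitz (KL) constant $C$ of $K_\epsilon$ is $C=O\left(n^2\,4^{2n}\,\|g_f\|_\infty/d\right)$, where $g_f$ is the outer function of $f$ and $n$ is dependent on $\epsilon$ in the way described in the context.
   Context: Kolmogorov superposition theorem, Lorentz version: there exist irrational numbers $0<\lambda_i\le 1$, $i=1,\dots,d$, and strictly increasing Lip($\alpha$) functions $\phi_q:[0,1]\to[0,1]$, $q=0,\dots,2d$, with $\alpha=\log_{10}2$, independent of $f$, such that for every $f\in C([0,1]^d)$ there is a continuous function $g$ on $[0,d]$ with $f(x_1,\dots,x_d)=\sum_{q=0}^{2d} g\left(\sum_{i=1}^d\lambda_i\phi_q(x_i)\right)$. The $\lambda_i,\phi_q$ are fixed, and $g=g_f$ is called the outer function of $f$. A function $f\in C([0,1]^d)$ is Kolmogorov-Lipschitz (KL) continuous if its outer function is Lipschitz continuous on $[0,d]$; the Lipschitz constant of the outer function is called the Kolmogorov-Lipschitz (KL) constant of $f$. $\|\cdot\|_\infty$ denotes the maximum norm. Description of $n$: $K_\epsilon$ is obtained by replacing $g_f$ in the representation of $f$ by a polynomial $p_\epsilon$ with $|p_\epsilon-g_f|\le\epsilon/(2d+1)$ on $[0,d]$. For $p_\epsilon$ one uses a Fejér-Hermite polynomial with $n$ nodes. For $g\in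 C[-1,1]$ this is $F_n(g;x)=\frac{T_n^2(x)}{n^2}\sum_{i=1}^n g(x_i)\frac{1-xx_i}{(x-x_i)^2}$, where $T_n$ is the Chebyshev polynomial of degree $n$ and $x_i=\cos((2i-1)\pi/(2n))$, $i=1,\dots,n$, are its zeros; it is carried over to $[0,d]$, with $g_f$ in place of $g$, by the change of variable $x\mapsto -1+2x/d$. The integer $n$ is taken large enough for the approximation estimate of $g$ by $F_n(g;\cdot)$ (written with a tolerance called $\epsilon$, and giving $|F_n(g;x)-g(x)|\le 2\epsilon$); the stated requirement is $n\ge\sqrt{2\|g\|_\infty/(\delta^2\epsilon)}$, where $\delta>0$ is such that $|g(x_i)-g(x)|\le\epsilon$ whenever $|x-x_i|<\delta$. *)

(* Defs.v *)
From HB Require Import structures.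
From mathcomp Require Import all_boot all_order all_algebra.
From mathcomp Require Import all_classical all_reals all_analysis.
Set Implicit Arguments.
Unset Strict Implicit.
Unset Printing Implicit Defensive.
Import Order.TTheory GRing.Theory Num.Theory.
Import numFieldNormedType.Exports.
Local Open Scope classical_set_scope.
Local Open Scope ring_scope.

Definition cube (R : realType) (d : nat) : set 'rV[R]_d :=
  [set x | forall i, x ord0 i \in `[0, 1]].

(* For h continuous on a nonempty compact D this is the maximum norm; `sup` is
   only meaningful on bounded sets, so it is applied to such h only. *)
Definition max_norm (R : realType) (T : Type) (D : set T) (h : T -> R) : R :=
  sup [set `|h x| | x in D].

(* The q-th inner argument sum_i lambda_i phi_q(x_i). *)
Definition inner_sum (R : realType) (d : nat) (lambda : 'I_d -> R)
    (phi : 'I_(2 * d).+1 -> R -> R) (q : 'I_(2 * d).+1) (x : 'rV[R]_d) : R :=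
  \sum_(i < d) lambda i * phi q (x ord0 i).

Definition outer_function (R : realType) (d : nat) (lambda : 'I_d -> R)
    (phi : 'I_(2 * d).+1 -> R -> R) (f : 'rV[R]_d -> R) (g : R -> R) : Prop :=
  {within `[0, d%:R], continuous g} /\
  forall x, cube x -> f x = \sum_(q < (2 * d).+1) g (inner_sum lambda phi q x).

(* The fixed data of Lorentz's version of Kolmogorov's superposition theorem,
   together with the superposition property itself. *)
Record lorentz_system (R : realType) (d : nat) (lambda : 'I_d -> R)
    (phi : 'I_(2 * d).+1 -> R -> R) : Prop := LorentzSystem {
  lorentz_lambda_irrational : forall i, @irrational R (lambda i) ;
  lorentz_lambda_gt0 : forall i, 0 < lambda i ;
  lorentz_lambda_le1 : forall i, lambda i <= 1 ;
  lorentz_phi_itv : forall q x, x \in `[0, 1] -> phi q x \in `[0, 1] ;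
  lorentz_phi_incr : forall q, {in `[0, 1] &, {homo phi q : x y / x < y}} ;
  (* Lip(alpha) with alpha = log_10 2 *)
  lorentz_phi_lip : forall q, exists c : R, forall x y,
    x \in `[0, 1] -> y \in `[0, 1] ->
    `|phi q x - phi q y| <= c * `|x - y| `^ (ln 2 / ln 10) ;
  lorentz_superposition : forall f : 'rV[R]_d -> R,
    {within @cube R d, continuous f} -> exists g, outer_function lambda phi f g
}.

(* g is an outer function of f with Lipschitz constant C.  Outer functions need
   not be unique, and C need not be the least constant. *)
Definition KL_constant (R : realType) (d : nat) (lambda : 'I_d -> R)
    (phi : 'I_(2 * d).+1 -> R -> R) (f : 'rV[R]_d -> R) (g : R -> R) (C : R) : Prop :=
  outer_function lambda phi f g /\
  C.-lipschitz_(`[0, d%:R]) (g : R^o -> R^o).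

Definition KL_continuous (R : realType) (d : nat) (lambda : 'I_d -> R)
    (phi : 'I_(2 * d).+1 -> R -> R) (f : 'rV[R]_d -> R) : Prop :=
  {within @cube R d, continuous f} /\
  exists g C, KL_constant lambda phi f g C.

Fixpoint chebyshev_poly (R : realType) (n : nat) : {poly R} :=
  match n with
  | 0 => 1
  | 1 => 'X
  | (n'.+1 as m).+1 => 2%:P * 'X * chebyshev_poly R m - chebyshev_poly R n'
  end.

(* The zeros of T_n; i is counted from 0, so 2 i - 1 becomes 2 i + 1. *)
Definition chebyshev_node (R : realType) (n i : nat) : R :=
  cos ((2 * i + 1)%:R * pi / (2 * n)%:R).

(* F_n(g; .) as a polynomial: T_n^2 / (x - x_i)^2 is the square of the exact
   quotient T_n %/ ('X - x_i).  Evaluating the fraction pointwise would give the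
   wrong value 0 at the nodes. *)
Definition fejer_hermite (R : realType) (n : nat) (g : R -> R) : {poly R} :=
  (n%:R ^- 2) *: \sum_(i < n) g (chebyshev_node R n i) *:
    ((1 - chebyshev_node R n i *: 'X) *
     (chebyshev_poly R n %/ ('X - (chebyshev_node R n i)%:P)) ^+ 2).

(* The change of variable y |-> -1 + 2 y / d from [0, d] to [-1, 1], used to
   pull a function on [0, d] back to [-1, 1] and to carry F_n to [0, d]. *)
Definition to_unit (R : realType) (d : nat) (y : R) : R := - 1 + 2 * y / d%:R.
Definition of_unit (R : realType) (d : nat) (t : R) : R := d%:R * (t + 1) / 2.

(* n is at least sqrt (2 ||g|| / (delta^2 tau)), with delta as in the estimate
   of F_n(g; .) - g with tolerance tau: only pairs (node, point) are involved. *)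
Definition enough_nodes (R : realType) (g : R -> R) (tau : R) (n : nat) : Prop :=
  (0 < n)%N /\
  exists delta : R, [/\ 0 < delta,
    forall (i : 'I_n) (x : R), x \in `[-1, 1] ->
      `|x - chebyshev_node R n i| < delta ->
      `|g (chebyshev_node R n i) - g x| <= tau
    & Num.sqrt (2 * max_norm `[-1, 1] g / (delta ^+ 2 * tau)) <= n%:R].

Definition fejer_hermite_estimate (R : realType) (g : R -> R) (tau : R)
    (n : nat) : Prop :=
  forall t, t \in `[-1, 1] -> `|(fejer_hermite n g).[t] - g t| <= 2 * tau.

(* Main.v *)
Require Import Defs.
From HB Require Import structures.
From mathcomp Require Import all_boot all_order all_algebra.
From mathcomp Require Import all_classical all_reals all_analysis.
From mathcomp Require Import zify ring lra.
Set Implicit Arguments.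
Unset Strict Implicit.
Unset Printing Implicit Defensive.
Import Order.TTheory GRing.Theory Num.Theory.
Import numFieldNormedType.Exports.
Local Open Scope classical_set_scope.
Local Open Scope ring_scope.

(** An approximation of the outer function gf within eps / (2 d + 1) on [0, d]
    gives one of f within eps, because f is a sum of 2 d + 1 values of gf; and
    the sum K of the same values of a Lipschitz p is KL continuous with outer
    function p.  It thus suffices to find Lipschitz approximations of
    g = gf o of_unit on [-1, 1] with error 2 tau, where 2 tau = eps / (2 d + 1);
    the change of variable multiplies Lipschitz constants by 2 / d.

    Large n.  Put Q_i = T_n / (X - x_i) and w_i = (1 - x_i X) Q_i^2.
    Differentiating Q_i (X - x_i) = T_n, multiplying by Q_i and summing over
    i, with T_n' = sum_i Q_i, gives sum_i Q_i^2 = T_n'^2 - T_n T_n''.  The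
    differential equation of T_n and Pell's identity then turn sum_i w_i into n^2
    ([sum_fejer_hermite_weight]): the w_i / n^2 form a partition of unity,
    nonnegative on [-1, 1].  The nodes closer than delta to x contribute at
    most tau to the error at x, by the choice of delta; each of the others has
    w_i(x) <= 2 / delta^2, so that they contribute O(||g|| / (n delta^2))
    ([fejer_hermite_error]).  Uniform continuity of gf provides one delta that
    serves all n.

    Lipschitz constant of F_n.  Q_i is a divided difference of T_n, hence obeys
    the three-term recurrence of T_n with an inhomogeneous term of size at most
    2; this bounds it by 3^n and its Lipschitz constant by n 3^n on [-1, 1].
    So F_n is Lipschitz with constant 5 * 9^n ||g||, which is
    O(n^2 4^(2 n) ||g||) ([fejer_hermite_lipschitz]).

    The bound n >= sqrt (2 ||g|| / (delta^2 tau)) is not enough for the above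
    proof that |F_n - g| <= 2 tau, which asks for n of order
    ||g|| / (delta^2 tau).  When the estimate fails, another approximation is
    used.  If ||g|| <= 2 tau, the zero function will do.  Otherwise
    n delta >= 2 > pi / 2, while every point of [-1, 1] is within pi / (2 n)
    of a node; the delta-balls around the nodes cover [-1, 1] with a margin
    proportional to 1 / n, and a minimum of truncated cones erected over the
    nodes is within tau of g with slope O(n ||g||)
    ([enough_nodes_lipschitz_approximation]). *)

(** * Chebyshev polynomials *)

Section Chebyshev.
Variable R : realType.
Implicit Types (n : nat) (x t a : R).

Local Notation T := (chebyshev_poly R).

(** The Chebyshev polynomial U_(n-1) of the second kind, generated together with
    T_n by multiplication by cos t + i sin t; U_(-1) = 0 fixes the shift. *)
Fixpoint chebyshev_cofactor n : {poly R} :=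
  if n is n'.+1 then 'X * chebyshev_cofactor n' + T n' else 0.

Local Notation U := chebyshev_cofactor.

Lemma chebyshev_polySS n : T n.+2 = 2 * 'X * T n.+1 - T n.
Proof. by rewrite /= polyC_natr. Qed.

Lemma chebyshev_polyS n : T n.+1 = 'X * T n - (1 - 'X ^+ 2) * U n.
Proof.
elim: n => [|n IH]; first by rewrite /=; ring.
have -> : T n.+2 = 2 * 'X * T n.+1 - T n by rewrite chebyshev_polySS.
have -> : U n.+1 = 'X * U n + T n by [].
by rewrite IH; ring.
Qed.

Lemma chebyshev_pell n : T n ^+ 2 + (1 - 'X ^+ 2) * U n ^+ 2 = 1.
Proof.
elim: n => [|n IH]; first by rewrite /=; ring.
rewrite chebyshev_polyS /= -[RHS]IH; ring.
Qed.

(** The two derivatives must be computed together: the induction step for T'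
    meets (1 - X^2) U', and conversely. *)
Lemma chebyshev_deriv n :
  (T n)^`() = n%:R * U n /\ (1 - 'X ^+ 2) * (U n)^`() = 'X * U n - n%:R * T n.
Proof.
elim: n => [|n [IT IU]]; first by rewrite /= deriv0 derivC; split; ring.
have dU1 : (U n.+1)^`() = U n + 'X * (U n)^`() + n%:R * U n.
  by rewrite /= derivD derivM derivX IT; ring.
split.
  rewrite chebyshev_polyS derivB !derivM derivB derivX derivXn derivC /= IT.
  transitivity (T n + 'X * (n%:R * U n) + 2 * 'X * U n
                - (1 - 'X ^+ 2) * (U n)^`()); first by rewrite mulr2n; ring.
  by rewrite IU -[in RHS](addn1 n) natrD; ring.
rewrite dU1 chebyshev_polyS /= -[in RHS](addn1 n) natrD.
transitivity ((1 - 'X ^+ 2) * (1 + n%:R) * U n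
              + 'X * ((1 - 'X ^+ 2) * (U n)^`())); first by ring.
by rewrite IU; ring.
Qed.

Lemma chebyshev_ode n :
  (1 - 'X ^+ 2) * (T n)^`()^`() = 'X * (T n)^`() - n%:R ^+ 2 * T n.
Proof.
have [dT dU] := chebyshev_deriv n.
rewrite dT derivM (_ : (n%:R : {poly R})^`() = 0); last first.
  by rewrite -polyC_natr derivC.
transitivity (n%:R * ((1 - 'X ^+ 2) * (U n)^`())); first by ring.
by rewrite dU; ring.
Qed.

Lemma horner_chebyshev_cos n t : (T n).[cos t] = cos (n%:R * t).
Proof.
suff [] : (T n).[cos t] = cos (n%:R * t) /\
    (T n.+1).[cos t] = cos (n.+1%:R * t) by [].
elim: n => [|n [IH0 IH1]].
  by rewrite /= hornerC hornerX mul0r cos0 mul1r.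
split=> //; rewrite chebyshev_polySS !hornerE IH0 IH1.
have -> : n.+2%:R * t = n.+1%:R * t + t by rewrite -addn1 natrD; ring.
have -> : n%:R * t = n.+1%:R * t - t by rewrite -[in RHS]addn1 natrD; ring.
by rewrite [cos (_ - t)]cosB cosD; ring.
Qed.

Lemma chebyshev_bounded n x : `|x| <= 1 -> `|(T n).[x]| <= 1.
Proof.
move=> x1.
have pell : (T n).[x] ^+ 2 + (1 - x ^+ 2) * (U n).[x] ^+ 2 = 1.
  by have := congr1 (horner^~ x) (chebyshev_pell n); rewrite !hornerE /=;
    apply: etrans; ring.
have x2 : x ^+ 2 <= 1 by rewrite -real_normK ?num_real// expr_le1.
rewrite -(@ler_pXn2r _ 2)// ?nnegrE// expr1n real_normK ?num_real//.
by rewrite -[leRHS]pell lerDl mulr_ge0 ?sqr_ge0// subr_ge0.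
Qed.

Lemma size_chebyshev n : size (T n) = n.+1.
Proof.
suff [] : size (T n) = n.+1 /\ size (T n.+1) = n.+2 by [].
elim: n => [|n [IH0 IH1]]; first by rewrite /= size_poly1 size_polyX.
split=> //; rewrite chebyshev_polySS.
have -> : 2 * 'X * T n.+1 = (2 : R) *: ('X * T n.+1).
  by rewrite -mul_polyC polyC_natr mulrA.
have Tn0 : T n.+1 != 0 by rewrite -size_poly_eq0 IH1.
rewrite size_polyDl size_scale ?pnatr_eq0// mulrC size_mulX// IH1//.
by rewrite size_polyN IH0.
Qed.

Lemma chebyshev_node_angle n i : (0 < n)%N ->
  n%:R * ((2 * i + 1)%:R * pi / (2 * n)%:R) = pi / 2 + i%:R * pi :> R.
Proof.
move=> n0; rewrite [(_ + 1)%:R]natrD !natrM.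
have n0' : n%:R != 0 :> R by rewrite pnatr_eq0 -lt0n.
by field.
Qed.

Lemma root_chebyshev n i : (0 < n)%N -> root (T n) (chebyshev_node R n i).
Proof.
move=> n0; apply/rootP; rewrite horner_chebyshev_cos chebyshev_node_angle//.
elim: i => [|i IH]; first by rewrite mul0r addr0 cos_pihalf.
by rewrite -[i.+1%:R]natr1 (mulrDl i%:R) mul1r addrA cosDpi IH oppr0.
Qed.

Lemma chebyshev_node_in n i : `|chebyshev_node R n i| <= 1.
Proof. by rewrite ler_norml cos_geN1 cos_le1. Qed.

Lemma chebyshev_node_inj n (i j : 'I_n) :
  chebyshev_node R n i = chebyshev_node R n j -> i = j.
Proof.
case: n i j => [[]//|n] i j.
have pi0 := pi_gt0 R.
have angle_in (k : 'I_n.+1) :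
    (2 * k + 1)%:R * pi / (2 * n.+1)%:R \in `[0, (pi : R)].
  rewrite in_itv/= divr_ge0 ?mulr_ge0 ?ltW//=.
  rewrite ltr_pdivrMr ?ltr0n// mulrC ltr_pM2l// ltr_nat.
  by have := ltn_ord k; lia.
move=> /cos_inj -/(_ (angle_in i) (angle_in j)) eq_angle.
have n0 : (n.+1%:R : R) != 0 by rewrite pnatr_eq0.
have /(congr1 ( *%R n.+1%:R)) := eq_angle.
rewrite !chebyshev_node_angle// => /addrI /(mulIf (lt0r_neq0 pi0)) /eqP.
by rewrite eqr_nat => /eqP /val_inj.
Qed.
End Chebyshev.

(** * Lipschitz constant of the Fejer-Hermite polynomials *)

Section FejerHermiteLipschitz.
Variable R : realType.
Implicit Types (n : nat) (x y a M : R) (g : R -> R).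

Local Notation T := (chebyshev_poly R).

(** (T_n(X) - T_n(a)) / (X - a), by the recurrence that it inherits from T_n.
    At a node a it is the quotient in the Fejer-Hermite formula, but here
    estimates follow by induction on n, without dividing by X - a. *)
Fixpoint chebyshev_divdiff a n : {poly R} :=
  match n with
  | 0 => 0
  | 1 => 1
  | (n'.+1 as m).+1 =>
      2 * 'X * chebyshev_divdiff a m - chebyshev_divdiff a n'
      + (2 * (T m).[a])%:P
  end.

Local Notation D := chebyshev_divdiff.

Lemma chebyshev_divdiffSS a n :
  D a n.+2 = 2 * 'X * D a n.+1 - D a n + (2 * (T n.+1).[a])%:P.
Proof. by []. Qed.

Lemma horner_chebyshev_divdiffSS a n x : (D a n.+2).[x] =
  2 * x * (D a n.+1).[x] - (D a n).[x] + 2 * (T n.+1).[a].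
Proof. by rewrite chebyshev_divdiffSS !hornerE. Qed.

Lemma chebyshev_divdiffP a n :
  T n = D a n * ('X - a%:P) + (T n).[a]%:P.
Proof.
suff [] : T n = D a n * ('X - a%:P) + (T n).[a]%:P /\
  T n.+1 = D a n.+1 * ('X - a%:P) + (T n.+1).[a]%:P by [].
elim: n => [|n [IH0 IH1]].
  by rewrite /= hornerC hornerX; split; ring.
split=> //.
have eva : (T n.+2).[a] = 2 * a * (T n.+1).[a] - (T n).[a].
  by rewrite chebyshev_polySS !hornerE.
rewrite eva chebyshev_polySS chebyshev_divdiffSS.
rewrite polyCB !polyCM polyC_natr.
rewrite [in LHS]IH1 [in LHS]IH0; ring.
Qed.

Lemma chebyshev_quotientE a n : root (T n) a -> T n %/ ('X - a%:P) = D a n.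
Proof.
move=> ra; have := chebyshev_divdiffP a n.
rewrite (rootP ra) addr0 => ->; rewrite mulpK// polyXsubC_eq0//.
Qed.

(** The recurrence and |T_n(a)| <= 1 give b_(n+2) <= 2 b_(n+1) + b_n + 2 for the
    bounds, which 3^n - 1 satisfies. *)
Lemma chebyshev_divdiff_bounded a n x : `|a| <= 1 -> `|x| <= 1 ->
  `|(D a n).[x]| <= 3 ^+ n - 1.
Proof.
move=> a1 x1.
suff [] : `|(D a n).[x]| <= 3 ^+ n - 1 /\ `|(D a n.+1).[x]| <= 3 ^+ n.+1 - 1.
  by [].
elim: n => [|n [IH0 IH1]].
  by rewrite /= !hornerC normr0 normr1 expr0 expr1; split; lra.
split=> //; rewrite horner_chebyshev_divdiffSS.
have Ta := chebyshev_bounded n.+1 a1.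
have xD : `|x * (D a n.+1).[x]| <= 3 ^+ n.+1 - 1.
  by rewrite normrM -[leRHS]mul1r ler_pM.
have p3 : (0 : R) < 3 ^+ n by rewrite exprn_gt0.
move: IH0 xD Ta; rewrite -mulrA !exprS !ler_norml; lra.
Qed.

Lemma dist_mul_le (u v u' v' : R) :
  `|u * v - u' * v'| <= `|u| * `|v - v'| + `|v'| * `|u - u'|.
Proof.
rewrite (_ : u * v - u' * v' = u * (v - v') + v' * (u - u')); last by ring.
by rewrite (le_trans (ler_normD _ _))// !normrM.
Qed.

(** The inhomogeneous term is constant, so the Lipschitz constants satisfy
    l_(n+2) <= 2 l_(n+1) + l_n + 2 * 3^(n+1). *)
Lemma chebyshev_divdiff_lipschitz a n x y :
    `|a| <= 1 -> `|x| <= 1 -> `|y| <= 1 ->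
  `|(D a n).[x] - (D a n).[y]| <= n%:R * 3 ^+ n * `|x - y|.
Proof.
move=> a1 x1 y1.
suff [] : `|(D a n).[x] - (D a n).[y]| <= n%:R * 3 ^+ n * `|x - y| /\
  `|(D a n.+1).[x] - (D a n.+1).[y]| <= n.+1%:R * 3 ^+ n.+1 * `|x - y|.
  by [].
elim: n => [|n [IH0 IH1]].
  by rewrite /= !hornerC !subrr !normr0 expr0 expr1 !mul0r mul1r mulr_ge0.
split=> //; rewrite !horner_chebyshev_divdiffSS.
have Dy := chebyshev_divdiff_bounded n.+1 a1 y1.
have xD : `|x * (D a n.+1).[x] - y * (D a n.+1).[y]| <=
    n.+1%:R * 3 ^+ n.+1 * `|x - y| + 3 ^+ n.+1 * `|x - y|.
  apply: le_trans (dist_mul_le _ _ _ _) _; apply: lerD.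
    by rewrite -[leRHS]mul1r ler_pM.
  by rewrite ler_wpM2r//; apply: le_trans Dy _; rewrite gerBl.
have p3 : (0 : R) <= 3 ^+ n * `|x - y| by rewrite mulr_ge0 ?exprn_ge0.
have p3n : (0 : R) <= n%:R * (3 ^+ n * `|x - y|) by rewrite mulr_ge0.
have e1 : n.+1%:R * 3 ^+ n.+1 * `|x - y| =
    3 * (n%:R * (3 ^+ n * `|x - y|)) + 3 * (3 ^+ n * `|x - y|) :> R.
  by rewrite exprS -[n.+1%:R]natr1; ring.
have e2 : n.+2%:R * 3 ^+ n.+2 * `|x - y| =
    9 * (n%:R * (3 ^+ n * `|x - y|)) + 18 * (3 ^+ n * `|x - y|) :> R.
  by rewrite !exprS -[n.+2%:R]natr1 -[n.+1%:R]natr1; ring.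
have e3 : 3 ^+ n.+1 * `|x - y| = 3 * (3 ^+ n * `|x - y|) by rewrite exprS; ring.
move: IH0 xD; rewrite e1 e2 e3 -(mulrA n%:R) !ler_norml; lra.
Qed.

(** n^2 times the Fejer-Hermite polynomial of a function that is 1 at the i-th
    node and 0 at the others. *)
Definition fejer_hermite_weight n (i : nat) : {poly R} :=
  (1 - chebyshev_node R n i *: 'X) *
     (chebyshev_poly R n %/ ('X - (chebyshev_node R n i)%:P)) ^+ 2.

Lemma fejer_hermite_weight_lipschitz n (i : 'I_n) x y :
    `|x| <= 1 -> `|y| <= 1 ->
  `|(fejer_hermite_weight n i).[x] - (fejer_hermite_weight n i).[y]|
    <= 5 * n%:R * 9 ^+ n * `|x - y|.
Proof.
move=> x1 y1; have n0 : (0 < n)%N by case: n i => [[]|].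
rewrite /fejer_hermite_weight chebyshev_quotientE ?root_chebyshev//.
have := chebyshev_node_in R n i; set a := chebyshev_node R n i => a1.
have hw z : ((1 - a *: 'X) * D a n ^+ 2).[z] = (1 - a * z) * (D a n).[z] ^+ 2.
  by rewrite hornerM horner_exp !hornerE.
rewrite !hw; set u := (D a n).[x]; set v := (D a n).[y].
have p3 : (1 : R) <= 3 ^+ n by rewrite exprn_ege1// ler1n.
have u3 : `|u| <= 3 ^+ n.
  by apply: le_trans (chebyshev_divdiff_bounded n a1 x1) _; lra.
have v3 : `|v| <= 3 ^+ n.
  by apply: le_trans (chebyshev_divdiff_bounded n a1 y1) _; lra.
have uv := chebyshev_divdiff_lipschitz n a1 x1 y1.
have -> : (9 : R) ^+ n = 3 ^+ n * 3 ^+ n.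
  by rewrite -exprMn; congr (_ ^+ _); ring.
have n1 : (1 : R) <= n%:R by rewrite ler1n.
have ax : `|1 - a * x| <= 2.
  rewrite (le_trans (ler_normB _ _))// normr1 normrM.
  have : `|a| * `|x| <= 1 by rewrite -[leRHS]mul1r ler_pM.
  lra.
have lin : `|(1 - a * x) - (1 - a * y)| <= `|x - y|.
  rewrite (_ : 1 - a * x - (1 - a * y) = a * (y - x)); last by ring.
  by rewrite normrM distrC -[leRHS]mul1r ler_pM.
have sq : `|u ^+ 2 - v ^+ 2| <= 2 * n%:R * (3 ^+ n * 3 ^+ n) * `|x - y|.
  rewrite (_ : u ^+ 2 - v ^+ 2 = (u + v) * (u - v)); last by ring.
  rewrite normrM (_ : 2 * n%:R * (3 ^+ n * 3 ^+ n) * `|x - y| =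
    (2 * 3 ^+ n) * (n%:R * 3 ^+ n * `|x - y|)); last by ring.
  rewrite ler_pM// (le_trans (ler_normD _ _))//; lra.
apply: le_trans (dist_mul_le _ _ _ _) _.
have v2 : `|v ^+ 2| <= 3 ^+ n * 3 ^+ n by rewrite expr2 normrM ler_pM.
have b1 : `|1 - a * x| * `|u ^+ 2 - v ^+ 2| <=
    2 * (2 * n%:R * (3 ^+ n * 3 ^+ n) * `|x - y|) by rewrite ler_pM.
have b2 : `|v ^+ 2| * `|1 - a * x - (1 - a * y)| <=
   3 ^+ n * 3 ^+ n * `|x - y| by rewrite ler_pM.
have b3 : 3 ^+ n * 3 ^+ n * `|x - y| <= n%:R * (3 ^+ n * 3 ^+ n * `|x - y|).
  by rewrite ler_peMl// !mulr_ge0// ?exprn_ge0.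
lra.
Qed.

Lemma fejer_hermiteE n g x : (fejer_hermite n g).[x] =
  n%:R ^- 2 * \sum_(i < n) g (chebyshev_node R n i) *
    (fejer_hermite_weight n i).[x].
Proof.
rewrite /fejer_hermite hornerZ horner_sum; congr (_ * _).
by apply: eq_bigr => i _; rewrite hornerZ.
Qed.

Lemma fejer_hermite_lipschitz n g M : (0 < n)%N ->
    (forall x, `|x| <= 1 -> `|g x| <= M) ->
  forall x y, `|x| <= 1 -> `|y| <= 1 ->
  `|(fejer_hermite n g).[x] - (fejer_hermite n g).[y]|
    <= 5 * 9 ^+ n * M * `|x - y|.
Proof.
move=> n0 gM x y x1 y1; have n0' : (0 : R) < n%:R by rewrite ltr0n.
rewrite !fejer_hermiteE -mulrBr normrM ger0_norm; last first.
  by rewrite invr_ge0 exprn_ge0.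
rewrite -sumrB.
apply: (@le_trans _ _ (n%:R ^- 2 *
    \sum_(i < n) M * (5 * n%:R * 9 ^+ n * `|x - y|))).
  rewrite ler_wpM2l ?invr_ge0 ?exprn_ge0//.
  apply: le_trans (ler_norm_sum _ _ _) _; apply: ler_sum => i _.
  by rewrite -mulrBr normrM ler_pM ?gM ?chebyshev_node_in//
    fejer_hermite_weight_lipschitz.
rewrite sumr_const card_ord -[_ *+ n]mulr_natl le_eqVlt; apply/orP; left.
by apply/eqP; field; rewrite pnatr_eq0 -lt0n.
Qed.

End FejerHermiteLipschitz.

(** * Error of the Fejer-Hermite approximation *)

Section FejerHermiteApproximation.
Variable R : realType.
Implicit Types (x M delta tau : R) (g : R -> R).

Local Notation T := (chebyshev_poly R).
Local Notation node := (chebyshev_node R).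
Local Notation Q n i := (T n %/ ('X - (node n i)%:P)).

Lemma chebyshev_quotientM n i : (0 < n)%N -> Q n i * ('X - (node n i)%:P) = T n.
Proof. by move=> n0; rewrite divpK// dvdp_XsubCl root_chebyshev. Qed.

Lemma deriv_chebyshev_quotientM n i : (0 < n)%N ->
  (Q n i)^`() * ('X - (node n i)%:P) + Q n i = (T n)^`().
Proof.
move=> n0; rewrite -[in RHS](chebyshev_quotientM i n0) derivM derivXsubC.
by rewrite mulr1.
Qed.

(** Logarithmic derivative of T_n.  Both sides have degree less than n, and at
    the node x_j both equal Q_j(x_j), as the other Q_i vanish there; the n nodes
    are distinct. *)
Lemma deriv_chebyshev_sum n : (0 < n)%N -> (T n)^`() = \sum_(i < n) Q n i.
Proof.
move=> n0; apply/eqP; rewrite -subr_eq0; apply/eqP.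
apply: (@roots_geq_poly_eq0 _ _ [seq node n (i : 'I_n) | i <- enum 'I_n]).
- apply/allP => _ /mapP[j _ ->]; apply/rootP.
  rewrite hornerD hornerN horner_sum (bigD1 j)//= big1 ?addr0; last first.
    move=> i ij.
    have := congr1 (horner^~ (node n j)) (chebyshev_quotientM i n0).
    rewrite /= hornerM hornerXsubC (rootP (root_chebyshev R j n0)) => /eqP.
    rewrite mulf_eq0 subr_eq0 => /orP[/eqP//|/eqP /chebyshev_node_inj ji].
    by rewrite ji eqxx in ij.
  rewrite -(deriv_chebyshev_quotientM j n0) hornerD hornerM hornerXsubC.
  by rewrite subrr mulr0 add0r subrr.
- by rewrite map_inj_uniq ?enum_uniq// => i j; apply: chebyshev_node_inj.
- rewrite size_map size_enum_ord (leq_trans (size_polyD _ _))// size_polyN.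
  rewrite geq_max; apply/andP; split.
    have := size_chebyshev R n; rewrite -ltnS => <-; apply: lt_size_deriv.
    by rewrite -size_poly_eq0 size_chebyshev.
  apply: (leq_trans (size_sum _ _ _)); apply/bigmax_leqP => i _.
  by rewrite size_divp ?polyXsubC_eq0// size_XsubC size_chebyshev subn1.
Qed.

(** Since 1 - x_i X = (1 - X^2) + X (X - x_i), the sum is
    (1 - X^2) sum_i Q_i^2 + X T_n sum_i Q_i, and both sums are expressed by
    derivatives of T_n. *)
Lemma sum_fejer_hermite_weight n : (0 < n)%N ->
  \sum_(i < n) fejer_hermite_weight R n i = n%:R ^+ 2.
Proof.
move=> n0; pose S1 := \sum_(i < n) Q n i.
pose S2 := \sum_(i < n) Q n i ^+ 2.
have S2E : T n * (T n)^`()^`() + S2 = (T n)^`() * S1.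
  (* Q_i times the derivative of Q_i (X - x_i) = T_n, summed over i. *)
  rewrite {1}(deriv_chebyshev_sum n0) raddf_sum !mulr_sumr -big_split/=.
  apply: eq_bigr => i _.
  rewrite -(deriv_chebyshev_quotientM i n0) -{1}(chebyshev_quotientM i n0).
  ring.
transitivity ((1 - 'X ^+ 2) * S2 + 'X * T n * S1).
  rewrite !mulr_sumr -big_split/=; apply: eq_bigr => i _.
  rewrite /fejer_hermite_weight -mul_polyC -{3}(chebyshev_quotientM i n0).
  ring.
have S1E : S1 = n%:R * chebyshev_cofactor R n.
  by rewrite /S1 -deriv_chebyshev_sum// (chebyshev_deriv R n).1.
have ode := chebyshev_ode R n.
rewrite (_ : S2 = (T n)^`() * S1 - T n * (T n)^`()^`()); last first.
  by rewrite -S2E; ring.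
transitivity ((1 - 'X ^+ 2) * ((T n)^`() * S1) + 'X * T n * S1
   - T n * ((1 - 'X ^+ 2) * (T n)^`()^`())); first by ring.
transitivity (n%:R ^+ 2 *
    (T n ^+ 2 + (1 - 'X ^+ 2) * chebyshev_cofactor R n ^+ 2)).
  by rewrite ode (chebyshev_deriv R n).1 S1E; ring.
by rewrite chebyshev_pell mulr1.
Qed.

Lemma node_mul_le1 n i x : `|x| <= 1 -> `|node n i * x| <= 1.
Proof.
by move=> x1; rewrite normrM -[leRHS]mul1r ler_pM ?chebyshev_node_in.
Qed.

Lemma fejer_hermite_weight_ge0 n i x : `|x| <= 1 ->
  0 <= (fejer_hermite_weight R n i).[x].
Proof.
move=> x1; rewrite hornerM horner_exp mulr_ge0 ?sqr_ge0// !hornerE.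
have := node_mul_le1 n i x1.
rewrite ler_norml; lra.
Qed.

(** Q_i(x) = T_n(x) / (x - x_i) with |T_n(x)| <= 1. *)
Lemma fejer_hermite_weight_far n i x delta : (0 < n)%N -> `|x| <= 1 ->
  0 < delta -> delta <= `|x - node n i| ->
  (fejer_hermite_weight R n i).[x] <= 2 / delta ^+ 2.
Proof.
move=> n0 x1 d0 dx; rewrite hornerM horner_exp; apply: ler_pM.
- have := fejer_hermite_weight_ge0 n i x1.
  have := node_mul_le1 n i x1.
  rewrite !hornerE ler_norml; lra.
- exact: sqr_ge0.
- have := node_mul_le1 n i x1.
  rewrite !hornerE ler_norml; lra.
have xn : 0 < `|x - node n i| by apply: lt_le_trans dx.
have QT : `|(Q n i).[x]| * `|x - node n i| <= 1.
  have := congr1 (horner^~ x) (chebyshev_quotientM i n0).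
  by rewrite /= hornerM hornerXsubC -normrM => ->; apply: chebyshev_bounded.
rewrite -real_normK ?num_real// -exprVn ler_pXn2r ?nnegrE ?invr_ge0 ?(ltW d0)//.
rewrite -[leRHS]mul1r ler_pdivlMr// (le_trans _ QT)//; exact: ler_wpM2l.
Qed.

(** The error is a mean of the g(x_i) - g(x) with weights w_i(x) / n^2.  The far
    nodes cost at most n * (2 M) * (2 / delta^2) / n^2, which is at most tau. *)
Lemma fejer_hermite_error n g M delta tau : (0 < n)%N -> 0 < delta ->
    (forall x, `|x| <= 1 -> `|g x| <= M) ->
    (forall (i : 'I_n) x, `|x| <= 1 -> `|x - node n i| < delta ->
      `|g (node n i) - g x| <= tau) ->
    0 < tau -> 4 * M / (delta ^+ 2 * tau) <= n%:R ->
  forall x, `|x| <= 1 -> `|(fejer_hermite n g).[x] - g x| <= 2 * tau.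
Proof.
move=> n0 d0 gM gtau tau0 nM x x1.
have n0' : (0 : R) < n%:R by rewrite ltr0n.
have M0 : 0 <= M by apply: le_trans (normr_ge0 (g x)) (gM x x1).
pose w i := (fejer_hermite_weight R n i).[x].
have w0 i : 0 <= w i by apply: fejer_hermite_weight_ge0.
have sw : \sum_(i < n) w i = n%:R ^+ 2.
  rewrite -horner_sum sum_fejer_hermite_weight//.
  by rewrite -polyC_natr -polyC_exp hornerC.
have d2 : 0 < delta ^+ 2 by rewrite exprn_gt0.
have -> : (fejer_hermite n g).[x] - g x =
    n%:R ^- 2 * \sum_(i < n) (g (node n i) - g x) * w i.
  rewrite fejer_hermiteE [in RHS](eq_bigr (fun i : 'I_n =>
    g (node n i) * w i - g x * w i)); last by move=> i _; rewrite mulrBl.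
  by rewrite sumrB -mulr_sumr sw mulrBr; field; rewrite gt_eqF.
rewrite normrM ger0_norm ?invr_ge0 ?exprn_ge0//.
rewrite mulrC ler_pdivrMr ?exprn_gt0//.
apply: le_trans (ler_norm_sum _ _ _) _.
apply: (@le_trans _ _ (\sum_(i < n) (tau * w i + 4 * M / delta ^+ 2))).
  apply: ler_sum => i _; rewrite normrM (ger0_norm (w0 i)).
  have [xi|xi] := ltP `|x - node n i| delta.
    have : 0 <= 4 * M / delta ^+ 2 by rewrite divr_ge0 ?mulr_ge0// ltW.
    have : `|g (node n i) - g x| * w i <= tau * w i.
      by rewrite ler_wpM2r// gtau.
    lra.
  have wi : w i <= 2 / delta ^+ 2 by apply: fejer_hermite_weight_far.
  have : `|g (node n i) - g x| * w i <= (2 * M) * (2 / delta ^+ 2).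
    rewrite ler_pM// (le_trans (ler_normB _ _))//.
    have := gM _ (chebyshev_node_in R n i); have := gM _ x1; lra.
  have : 0 <= tau * w i by rewrite mulr_ge0 ?(ltW tau0).
  lra.
rewrite big_split/= -mulr_sumr sw sumr_const card_ord -[_ *+ n]mulr_natl.
have : 4 * M / delta ^+ 2 <= tau * n%:R.
  move: nM; rewrite invfM mulrA ler_pdivrMr//; lra.
move/(ler_wpM2l (ltW n0')); lra.
Qed.

End FejerHermiteApproximation.

(** * Lipschitz approximation from the values at a net *)

Section NetApproximation.
Variable R : realType.
Implicit Types (x y z L M r delta tau : R) (g : R -> R).

Local Notation node := (chebyshev_node R).

Lemma cos_lipschitz x y : `|cos x - cos y| <= `|x - y|.
Proof.
wlog xy : x y / x < y.
  have [xy|xy|->] := ltgtP x y; last by rewrite !subrr normr0.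
    by move=> /(_ _ _ xy).
  by move=> /(_ _ _ xy); rewrite distrC (distrC y).
have dcos z : z \in `]x, y[ -> is_derive z 1 (@cos R) (- sin z).
  by move=> _; apply: is_derive_cos.
have ccos : {within `[x, y], continuous (@cos R)}.
  by apply: continuous_subspaceT => z; apply: continuous_cos.
have [z _ e] := MVT xy dcos ccos.
rewrite distrC e normrM (distrC x) -[leRHS]mul1r ler_wpM2r// normrN.
by rewrite ler_norml sin_geN1 sin_le1.
Qed.

Lemma grid_cell (h t : R) m : (0 < m)%N -> 0 <= t -> t <= m%:R * h ->
  exists2 i : 'I_m, i%:R * h <= t & t <= i.+1%:R * h.
Proof.
case: m => // m _ t0; elim: m => [|m IH] tm.
  by exists ord0; rewrite // mul0r.
have [tm'|tm'] := leP t (m.+1%:R * h); last by exists ord_max => //; exact: ltW.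
by have [i it ti] := IH tm'; exists (widen_ord (leqnSn _) i).
Qed.

(** The angle of x lies in one of the n cells of length pi / n that divide
    [0, pi]; the angle of a node is the midpoint of its cell, and cos does not
    increase distances. *)
Lemma chebyshev_node_cover n x : (0 < n)%N -> `|x| <= 1 ->
  exists i : 'I_n, `|x - node n i| <= pi / (2 * n)%:R.
Proof.
move=> n0 x1; have n0' : n%:R != 0 :> R by rewrite pnatr_eq0 -lt0n.
have xin : x \in `[-1, 1] by rewrite in_itv/= -ler_norml.
have [t0 tpi] : 0 <= acos x /\ acos x <= pi.
  by split; [apply: acos_ge0|apply: acos_lepi]; rewrite -ler_norml.
have tn : acos x <= n%:R * (pi / n%:R) by rewrite mulrC divfK.
have [i it ti] := grid_cell n0 t0 tn; exists i.
rewrite -[x in leLHS]acosK// (le_trans (cos_lipschitz _ _))//.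
have -> : (2 * i + 1)%:R * pi / (2 * n)%:R =
    i%:R * (pi / n%:R) + pi / (2 * n)%:R :> R.
  by rewrite [(_ + 1)%:R]natrD !natrM; field.
have e : i.+1%:R * (pi / n%:R) =
    i%:R * (pi / n%:R) + 2 * (pi / (2 * n)%:R) :> R.
  by rewrite -[i.+1%:R]natr1 natrM; field.
move: it ti; rewrite e ler_norml; lra.
Qed.

(** The minimum of the functions g(z_i) + L max (0, |x - z_i| - r), truncated at
    M.  Being flat on the r-ball of z_i, the i-th one is at most g(x) + tau for
    a z_i that covers x.  Conversely, a function centred within delta of x is
    at least g(x) - tau, and one centred farther away has already climbed by
    L (delta - r) >= 2 M, from -M or more up to M or more. *)
Lemma lipschitz_net_approximation n (z : 'I_n -> R) (A : set R) g
    M r delta tau L :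
    0 <= tau -> 0 <= L -> 2 * M <= L * (delta - r) ->
    (forall i, A (z i)) -> (forall x, A x -> `|g x| <= M) ->
    (forall x, A x -> exists i, `|x - z i| <= r) -> r < delta ->
    (forall i x, A x -> `|x - z i| < delta -> `|g (z i) - g x| <= tau) ->
  exists p : R -> R, (forall x y, `|p x - p y| <= L * `|x - y|) /\
    forall x, A x -> `|p x - g x| <= tau.
Proof.
move=> tau0 L0 ML Az gM cover rd osc.
pose F i x := g (z i) + L * Num.max 0 (`|x - z i| - r).
pose p x := \big[Num.min/M]_(i < n) F i x.
have pM x : p x <= M by apply: bigmin_le_id.
have pF x i : p x <= F i x by apply: bigmin_le.
have lb x c : c <= M -> (forall i, c <= F i x) -> c <= p x.
  by move=> cM cF; apply: le_bigmin.
have pxy x y : p x - L * `|x - y| <= p y.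
  have Lxy : 0 <= L * `|x - y| by rewrite mulr_ge0.
  apply: lb => [|i]; first by have := pM x; lra.
  suff : F i x <= F i y + L * `|x - y| by have := pF x i; lra.
  rewrite /F -addrA lerD2l -mulrDr ler_wpM2l//.
  have : `|x - z i| <= `|y - z i| + `|x - y|.
    rewrite addrC; apply: le_trans (ler_normD _ _).
    by rewrite le_eqVlt; apply/orP; left; apply/eqP; congr `|_|; ring.
  have := normr_ge0 (x - y).
  rewrite /Num.max; case: ifP => _;
    case: ifP => [|/negbT]; rewrite -?leNgt; lra.
exists p; split=> [x y|x Ax].
  by have := pxy x y; have := pxy y x; rewrite (distrC y) ler_norml; lra.
have [j xj] := cover x Ax.
have near_j : `|g (z j) - g x| <= tau.
  by apply: osc => //; apply: le_lt_trans rd.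
have Fj : F j x = g (z j) by rewrite /F max_l ?mulr0 ?addr0// subr_le0.
have gx := gM x Ax.
have : g x - tau <= p x.
  apply: lb => [|i]; first by move: gx; rewrite ler_norml; lra.
  have [xi|xi] := ltP `|x - z i| delta.
    have := osc i x Ax xi.
    have : 0 <= L * Num.max 0 (`|x - z i| - r).
      by rewrite mulr_ge0// le_max lexx.
    rewrite /F ler_norml; lra.
  have : L * (delta - r) <= L * Num.max 0 (`|x - z i| - r).
    by rewrite ler_wpM2l// le_max; apply/orP; right; rewrite lerD2r.
  have := gM _ (Az i); move: gx.
  rewrite /F !ler_norml; lra.
have := pF x j; rewrite Fj; move: near_j; rewrite !ler_norml; lra.
Qed.

(** The margin between n delta >= 2 and n r = pi / 2 makes L (delta - r) >= 2 M
    hold for L equal to this constant times n M. *)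
Definition net_constant : R := 2 / (2 - pi / 2).

Lemma net_constant_gt0 : 0 < net_constant.
Proof. by have /andP[_ pi2] := pihalf_02 R; rewrite divr_gt0// subr_gt0. Qed.

(** The lower bound on n gives (n delta)^2 >= 2 M / tau, which exceeds 4 unless
    M <= 2 tau. *)
Lemma enough_nodes_lipschitz_approximation n g M delta tau :
    (0 < n)%N -> 0 < delta -> 0 < tau -> (forall x, `|x| <= 1 -> `|g x| <= M) ->
    (forall (i : 'I_n) x, `|x| <= 1 -> `|x - node n i| < delta ->
      `|g (node n i) - g x| <= tau) ->
    Num.sqrt (2 * M / (delta ^+ 2 * tau)) <= n%:R ->
  exists (p : R -> R) L,
    [/\ 0 <= L, L <= net_constant * n%:R * M,
        forall x y, `|p x - p y| <= L * `|x - y|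
      & forall x, `|x| <= 1 -> `|p x - g x| <= 2 * tau].
Proof.
move=> n0 d0 tau0 gM osc nM.
have n0' : (0 : R) < n%:R by rewrite ltr0n.
have M0 : 0 <= M by rewrite (le_trans _ (gM 0 _))// normr0.
have c0 := net_constant_gt0.
have [Mt|Mt] := leP M (2 * tau).
  exists (fun=> 0), 0; split => // [|x y|x x1].
  - by rewrite mulr_ge0// mulr_ge0// ltW.
  - by rewrite subrr normr0 mul0r.
  - by rewrite sub0r normrN (le_trans (gM x x1)).
have /andP[_ pi2] := pihalf_02 R.
have nd : 2 <= n%:R * delta.
  have n2 : 2 * M / (delta ^+ 2 * tau) <= n%:R ^+ 2.
    rewrite -[leLHS]sqr_sqrtr; last first.
      by rewrite divr_ge0 ?mulr_ge0 ?sqr_ge0// ltW.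
    by rewrite ler_pXn2r// ?nnegrE ?sqrtr_ge0// (ltW n0').
  rewrite -(@ler_pXn2r _ 2)// ?nnegrE ?mulr_ge0 ?(ltW d0)//.
  move: n2; rewrite ler_pdivrMr ?mulr_gt0 ?exprn_gt0// => n2.
  suff : 2 ^+ 2 * tau <= (n%:R * delta) ^+ 2 * tau by rewrite ler_pM2r.
  rewrite exprMn; lra.
pose r : R := pi / (2 * n)%:R.
have dr : (2 - pi / 2) / n%:R <= delta - r.
  rewrite ler_pdivrMr// mulrBl (_ : r * n%:R = pi / 2) ?[delta * _]mulrC.
    lra.
  by rewrite /r natrM; field; rewrite gt_eqF.
have dr0 : (0 : R) < (2 - pi / 2) / n%:R.
  by apply: divr_gt0; rewrite // subr_gt0.
pose L := net_constant * n%:R * M.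
have L0 : 0 <= L by rewrite mulr_ge0// mulr_ge0// ltW.
have ML : 2 * M <= L * (delta - r).
  apply: le_trans (ler_wpM2l L0 dr).
  rewrite le_eqVlt; apply/orP; left; apply/eqP.
  rewrite /L /net_constant; move: (2 - pi / 2) (dr0) => c cn0.
  have [c0' n0''] : c != 0 /\ n%:R != 0 :> R.
    by split; rewrite gt_eqF//; move: cn0; rewrite pmulr_lgt0 ?invr_gt0.
  by field; rewrite c0' n0''.
have cover x : `|x| <= 1 -> exists i : 'I_n, `|x - node n i| <= r.
  exact: chebyshev_node_cover.
have rd : r < delta by rewrite -subr_gt0 (lt_le_trans dr0).
have [p [pL pg]] := @lipschitz_net_approximation n (fun i => node n i)
  [set x | `|x| <= 1] g M r delta tau L (ltW tau0) L0 ML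
  (fun i => chebyshev_node_in R n i) gM cover rd osc.
exists p, L; split=> // x x1; apply: le_trans (pg x x1) _; lra.
Qed.

End NetApproximation.

(** * Continuity on subsets *)

Section Continuity.
Variable R : realType.

Lemma within_continuousP (X : topologicalType) (A : set X) (f : X -> R) :
  {within A, continuous f} <->
  forall x, A x -> forall e, 0 < e ->
    \forall y \near x, A y -> `|f x - f y| < e.
Proof.
rewrite subspace_continuousP; split=> [cf x Ax e e0|cf x Ax].
  exact: (@cvgrPdist_lt _ _ _ (within A (nbhs x)) _ f (f x)).1 (cf x Ax) e e0.
by apply/cvgrPdist_lt => e e0; exact: cf.
Qed.

Lemma segment_uniform_continuous (a b : R) (f : R -> R) (tau : R) :
    {within `[a, b], continuous f} -> 0 < tau ->
  exists2 delta : R, 0 < delta & forall x y, x \in `[a, b] -> y \in `[a, b] ->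
    `|x - y| < delta -> `|f x - f y| <= tau.
Proof.
move=> /within_continuousP cf tau0.
have /compact_near_coveringP/near_covering_withinP cover :=
  @segment_compact R a b.
pose P (d : R) (x : R) :=
  forall y, y \in `[a, b] -> `|x - y| < d -> `|f x - f y| <= tau.
have : \forall d \near (0 : R)^'+, `[a, b]%classic `<=` P d.
  apply: cover => x xab.
  have t2 : 0 < tau / 2 by rewrite divr_gt0.
  have /nbhs_ballP[e /= e0 fe] := cf x xab _ t2.
  have e2 : 0 < e / 2 by rewrite divr_gt0.
  near=> z d => zab y yab zy.
  have xz : `|x - z| < e / 2 by near: z; apply: cvgr_dist_lt.
  have de : d < e / 2 by near: d; apply: nbhs_right_lt.
  have fz : `|f x - f z| < tau / 2.
    by apply: fe => //; rewrite /ball/= (lt_trans xz)// ltr_pdivrMr//; lra.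
  have fy : `|f x - f y| < tau / 2.
    apply: fe => //; rewrite /ball/=.
    apply: (le_lt_trans (ler_distD (z : R) _ _)).
    by rewrite (splitr e) ltrD// (lt_trans zy).
  rewrite (le_trans (ler_distD (f x) _ _))// (splitr tau) distrC.
  by apply: lerD; apply: ltW.
move=> near_d.
have : \forall d \near (0 : R)^'+, 0 < d /\ `[a, b]%classic `<=` P d.
  by near=> d; split; near: d => //; exact: nbhs_right_gt.
by move=> /filter_ex[d [d0 Pd]]; exists d => // x y xab; apply: Pd.
Unshelve. all: by end_near.
Qed.

Lemma lipschitz_within_continuous (A : set R) (p : R -> R) (C : R) :
    (forall x y, A x -> A y -> `|p x - p y| <= C * `|x - y|) ->
  {within A, continuous p}.
Proof.
move=> pC; apply/within_continuousP => x Ax e e0.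
have C0 : 0 < `|C| + 1 by rewrite ltr_wpDl.
have e1 : 0 < e / (`|C| + 1) by rewrite divr_gt0.
have : \forall y \near x, `|x - y| < e / (`|C| + 1).
  exact: (nbhsx_ballx x _ e1).
apply: filterS => y; rewrite ltr_pdivlMr// => xy Ay.
apply: le_lt_trans (pC _ _ Ax Ay) _; apply: le_lt_trans xy.
by rewrite mulrC ler_wpM2l// (le_trans (ler_norm C))// lerDl.
Qed.

Lemma within_continuous_sum (X : topologicalType) (A : set X) (n : nat)
    (F : 'I_n -> X -> R) : (forall i, {within A, continuous (F i)}) ->
  {within A, continuous (fun x => \sum_(i < n) F i x)}.
Proof.
move=> cF; apply: (@continuous_big R 'I_n +%R 0 predT _ (subspace A)) => //.
  exact: add_continuous.
by move=> i _; exact: cF.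
Qed.

Lemma within_continuous_comp (X : topologicalType) (A : set X) (B : set R)
    (h : X -> R) (p : R -> R) :
    (forall x, A x -> B (h x)) ->
    {within A, continuous h} -> {within B, continuous p} ->
  {within A, continuous (fun x => p (h x))}.
Proof.
move=> AB /within_continuousP ch /within_continuousP cp.
apply/within_continuousP => x Ax e e0.
have /nbhs_ballP[r /= r0 pr] := cp _ (AB x Ax) e e0.
by apply: filterS (ch x Ax r r0) => y hy Ay; apply: pr; [exact: hy|exact: AB].
Qed.

Lemma powR_small (c alpha e : R) : 0 < alpha -> 0 < e ->
  exists2 delta : R, 0 < delta &
    forall s, 0 <= s -> s < delta -> c * s `^ alpha < e.
Proof.
move=> a0 e0; have C0 : 0 < `|c| + 1 by rewrite ltr_wpDl.
have e1 : 0 < e / (`|c| + 1) by rewrite divr_gt0.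
exists ((e / (`|c| + 1)) `^ alpha^-1); first by rewrite powR_gt0.
move=> s s0 sd.
have : s `^ alpha < e / (`|c| + 1).
  have := gt0_ltr_powR a0 _ _ sd; rewrite !nnegrE => /(_ s0 (powR_ge0 _ _)).
  by rewrite -powRrM mulVf ?gt_eqF// powRr1// ltW.
rewrite ltr_pdivlMr// => se; apply: le_lt_trans se.
by rewrite mulrC ler_wpM2l ?powR_ge0// (le_trans (ler_norm c))// lerDl.
Qed.

End Continuity.

(** * Superpositions with a Lipschitz outer function *)

Section KolmogorovLipschitz.
Variables (R : realType) (d : nat) (lambda : 'I_d -> R).
Variable phi : 'I_(2 * d).+1 -> R -> R.
Hypothesis lorentz : lorentz_system lambda phi.

Lemma inner_sum_in q x : cube x -> inner_sum lambda phi q x \in `[0, d%:R].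
Proof.
move=> xc; have term i : 0 <= lambda i * phi q (x ord0 i) <= 1.
  have := lorentz_phi_itv lorentz q (xc i); rewrite in_itv/= => /andP[p0 p1].
  have l0 := ltW (lorentz_lambda_gt0 lorentz i).
  by rewrite mulr_ge0//= -[leRHS]mul1r ler_pM// (lorentz_lambda_le1 lorentz).
rewrite in_itv/= /inner_sum; apply/andP; split.
  by apply: sumr_ge0 => i _; case/andP: (term i).
rewrite -[d in leRHS]card_ord -sumr_const.
by apply: ler_sum => i _; case/andP: (term i).
Qed.

Lemma inner_sum_continuous q :
  {within @cube R d, continuous (inner_sum lambda phi q)}.
Proof.
apply: within_continuous_sum => i.
apply/subspace_continuousP => x xc; apply: cvgMr.
apply/cvgrPdist_lt => e e0.
have [c lip] := lorentz_phi_lip lorentz q.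
have a0 : 0 < ln 2 / ln 10 :> R by rewrite divr_gt0// ln_gt0// ltr1n.
have [delta delta0 small] := powR_small c a0 e0.
have near_x : \forall y \near x, `|x ord0 i - (y : 'rV[R]_d) ord0 i| < delta.
  by have /cvgrPdist_lt/(_ delta delta0) := @coord_continuous R 1 d ord0 i x.
apply: filterS near_x => y xy yc.
by apply: le_lt_trans (lip _ _ (xc i) (yc i)) _; apply: small.
Qed.

Definition superposition (p : R -> R) (x : 'rV[R]_d) : R :=
  \sum_(q < (2 * d).+1) p (inner_sum lambda phi q x).

Lemma lipschitz_KL_constant (p : R -> R) (C : R) :
    (forall y z, y \in `[0, d%:R] -> z \in `[0, d%:R] ->
      `|p y - p z| <= C * `|y - z|) ->
  KL_constant lambda phi (superposition p) p C.
Proof.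
move=> pC; split; last by move=> [y z] [/= yd zd]; exact: pC.
by split=> //; apply: (@lipschitz_within_continuous _ _ _ C) => y z; exact: pC.
Qed.

Lemma lipschitz_KL_continuous (p : R -> R) (C : R) :
    (forall y z, y \in `[0, d%:R] -> z \in `[0, d%:R] ->
      `|p y - p z| <= C * `|y - z|) ->
  KL_continuous lambda phi (superposition p).
Proof.
move=> pC; split; last by exists p, C; exact: lipschitz_KL_constant.
have cp : {within `[0, d%:R], continuous p}.
  by apply: (@lipschitz_within_continuous _ _ _ C) => y z; exact: pC.
apply: within_continuous_sum => q.
apply: within_continuous_comp cp; last exact: inner_sum_continuous.
by move=> x; exact: inner_sum_in.
Qed.

Lemma max_norm_superposition (f : 'rV[R]_d -> R) (gf p : R -> R) (eps : R) :
    outer_function lambda phi f gf ->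
    (forall y, y \in `[0, d%:R] -> `|p y - gf y| <= eps / (2 * d + 1)%:R) ->
  max_norm (@cube R d) (fun x => f x - superposition p x) <= eps.
Proof.
move=> [_ fE] pg; apply: ge_sup.
  exists `|f 0 - superposition p 0|; exists 0 => // i.
  by rewrite mxE in_itv/= lexx ler01.
move=> _ [x xc <-]; rewrite fE// -sumrB.
apply: le_trans (ler_norm_sum _ _ _) _.
apply: (@le_trans _ _ (\sum_(q < (2 * d).+1) eps / (2 * d + 1)%:R)).
  by apply: ler_sum => q _; rewrite distrC pg// inner_sum_in.
by rewrite sumr_const card_ord -[leLHS]mulr_natr addn1 divfK.
Qed.

End KolmogorovLipschitz.

(** * The change of variable between [0, d] and [-1, 1] *)

Section ChangeOfVariable.
Variables (R : realType) (d : nat).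
Hypothesis d_gt0 : (0 < d)%N.

Let d0 : (0 : R) < d%:R. Proof. by rewrite ltr0n. Qed.

Lemma to_unit_in (y : R) : y \in `[0, d%:R] -> `|to_unit d y| <= 1.
Proof.
rewrite in_itv/= => /andP[y0 yd]; rewrite /to_unit.
have yd0 : 0 <= y / d%:R by rewrite divr_ge0.
have yd1 : y / d%:R <= 1 by rewrite ler_pdivrMr// mul1r.
rewrite ler_norml; lra.
Qed.

Lemma of_unit_in (t : R) : `|t| <= 1 -> of_unit d t \in `[0, d%:R].
Proof.
rewrite ler_norml => /andP[t0 t1]; rewrite in_itv/= /of_unit.
rewrite divr_ge0 ?mulr_ge0//=; last lra.
by rewrite -mulrA -[leRHS]mulr1 ler_wpM2l//; lra.
Qed.

Lemma to_unitK : cancel (@to_unit R d) (of_unit d).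
Proof. by move=> y; rewrite /of_unit /to_unit; field; rewrite gt_eqF. Qed.

Lemma to_unit_dist (x y : R) :
  `|to_unit d x - to_unit d y| = 2 / d%:R * `|x - y|.
Proof.
rewrite -[2 / d%:R]ger0_norm ?divr_ge0// -normrM; congr `|_|.
by rewrite /to_unit; ring.
Qed.

Lemma of_unit_dist (s t : R) :
  `|of_unit d s - of_unit d t| = d%:R / 2 * `|s - t|.
Proof.
rewrite -[d%:R / 2]ger0_norm ?divr_ge0// -normrM; congr `|_|.
by rewrite /of_unit; ring.
Qed.

Lemma max_norm_of_unit (h : R -> R) :
  max_norm `[-1, 1] (fun t => h (of_unit d t)) = max_norm `[0, d%:R] h.
Proof.
rewrite /max_norm; congr sup; apply/seteqP; split=> [z [t]|z [y]].
  rewrite /= in_itv/= -ler_norml => t1 <-.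
  by exists (of_unit d t) => //; exact: of_unit_in.
move=> /= yd <-; exists (to_unit d y); last by rewrite to_unitK.
by rewrite /= in_itv/= -ler_norml to_unit_in.
Qed.

End ChangeOfVariable.

Lemma le_max_norm (R : realType) (a b : R) (h : R -> R) (x : R) :
    {within `[a, b], continuous h} -> x \in `[a, b] ->
  `|h x| <= max_norm `[a, b] h.
Proof.
move=> ch xab; apply: ub_le_sup; last by exists x.
have ab : a <= b by move: xab; rewrite in_itv/= => /andP[]; exact: le_trans.
have cnh : {within `[a, b], continuous (fun y => `|h y|)}.
  apply/within_continuousP => y yab e e0.
  have /within_continuousP/(_ y yab e e0) := ch.
  apply: filterS => z hz zab.
  by apply: le_lt_trans (hz zab); exact: ler_dist_dist.
have [c _ cmax] := EVT_max ab cnh.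
by exists `|h c| => _ [y yab <-]; exact: cmax.
Qed.

(** * Approximation of the outer function *)

Section OuterApproximation.
Variables (R : realType) (d : nat) (lambda : 'I_d -> R).
Variable phi : 'I_(2 * d).+1 -> R -> R.
Hypothesis lorentz : lorentz_system lambda phi.
Hypothesis d_gt0 : (0 < d)%N.
Variables (f : 'rV[R]_d -> R) (gf : R -> R) (eps : R).
Hypothesis eps_gt0 : 0 < eps.
Hypothesis outer : outer_function lambda phi f gf.

Let g (t : R) := gf (of_unit d t).
Let tau : R := eps / (2 * (2 * d + 1)%:R).
Let M := max_norm `[0, d%:R] gf.

Let d0 : (0 : R) < d%:R. Proof. by rewrite ltr0n. Qed.

Let tau_gt0 : 0 < tau.
Proof. by rewrite divr_gt0// mulr_gt0// ltr0n addn1. Qed.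

Let eps_tau : 2 * tau = eps / (2 * d + 1)%:R.
Proof. by rewrite /tau invfM mulrCA [2 * _]mulrA mulfV ?pnatr_eq0// mul1r. Qed.

Lemma outer_le_max_norm (t : R) : `|t| <= 1 -> `|g t| <= M.
Proof. by move=> t1; apply: le_max_norm outer.1 _; exact: of_unit_in. Qed.

Lemma outer_max_norm_ge0 : 0 <= M.
Proof. by rewrite (le_trans _ (@outer_le_max_norm 0 _))// normr0. Qed.

Lemma KL_approximation (P : R -> R) (L : R) :
    (forall s t, `|s| <= 1 -> `|t| <= 1 -> `|P s - P t| <= L * `|s - t|) ->
    (forall t, `|t| <= 1 -> `|P t - g t| <= 2 * tau) ->
  let p := fun y => P (to_unit d y) in
  let K := superposition lambda phi p in
  [/\ KL_continuous lambda phi K,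
      max_norm (@cube R d) (fun x => f x - K x) <= eps
    & KL_constant lambda phi K p (L * (2 / d%:R))].
Proof.
move=> PL Pg p K.
have pL y z : y \in `[0, d%:R] -> z \in `[0, d%:R] ->
    `|p y - p z| <= L * (2 / d%:R) * `|y - z|.
  by move=> yd zd; rewrite -mulrA -to_unit_dist// PL// to_unit_in.
split.
- exact: lipschitz_KL_continuous pL.
- apply: (max_norm_superposition lorentz outer) => y yd.
  by rewrite -eps_tau -{2}(to_unitK d_gt0 y) Pg// to_unit_in.
- exact: lipschitz_KL_constant.
Qed.

Lemma enough_nodes_large :
  exists N, forall n, (N <= n)%N ->
    enough_nodes g tau n /\ fejer_hermite_estimate g tau n.
Proof.
have [del del0 osc] := segment_uniform_continuous outer.1 tau_gt0.
pose delta : R := del / d%:R * 2.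
have delta0 : 0 < delta by rewrite mulr_gt0// divr_gt0.
have oscg (s t : R) : `|s| <= 1 -> `|t| <= 1 -> `|t - s| < delta ->
    `|g s - g t| <= tau.
  move=> s1 t1 st; apply: osc; rewrite ?of_unit_in// of_unit_dist// distrC.
  by rewrite mulrC -ltr_pdivlMr ?divr_gt0// invf_div mulrA mulrAC.
pose B := 4 * M / (delta ^+ 2 * tau).
have M0 := outer_max_norm_ge0.
have den0 : 0 < delta ^+ 2 * tau by rewrite mulr_gt0// exprn_gt0.
have B0 : 0 <= B by rewrite divr_ge0 ?mulr_ge0// ltW.
exists (Num.trunc B).+1 => n Nn.
have n0 : (0 < n)%N by apply: leq_trans Nn.
have Bn : B <= n%:R.
  by apply: (le_trans (ltW (truncnS_gt B))); rewrite ler_nat.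
have n1 : (1 : R) <= n%:R by rewrite ler1n.
split.
  split=> //; exists delta; split=> //.
    move=> i x; rewrite in_itv/= -ler_norml => x1; apply: oscg => //.
    exact: chebyshev_node_in.
  rewrite max_norm_of_unit// -/M -[leRHS]ger0_norm// -sqrtr_sqr.
  rewrite ler_sqrt ?sqr_ge0//.
  apply: (@le_trans _ _ B); first by rewrite ler_pM2r ?invr_gt0//; lra.
  by rewrite (le_trans Bn)// expr2 ler_peMr.
move=> t; rewrite in_itv/= -ler_norml.
apply: (@fejer_hermite_error _ n g M delta tau) => //.
  exact: outer_le_max_norm.
by move=> i x x1; apply: oscg => //; exact: chebyshev_node_in.
Qed.

(** F_n itself when it satisfies the estimate, and otherwise the minimum of
    cones.  The factor 10 = 5 * 2 comes from the Lipschitz constant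
    5 * 9^n M of F_n and the factor 2 / d of the change of variable. *)
Lemma KL_approximation_nodes n : enough_nodes g tau n ->
  exists (K : 'rV[R]_d -> R) (p : R -> R) (C : R),
    [/\ KL_continuous lambda phi K,
        max_norm (@cube R d) (fun x => f x - K x) <= eps,
        KL_constant lambda phi K p C,
        C <= (10 + 2 * net_constant R) *
             (n%:R ^+ 2 * 4 ^+ (2 * n) * M / d%:R)
      & fejer_hermite_estimate g tau n ->
        forall y, y \in `[0, d%:R] -> p y = (fejer_hermite n g).[to_unit d y]].
Proof.
move=> [n0 [delta [delta0 osc nM]]].
have gM := outer_le_max_norm.
have Md0 : 0 <= M / d%:R by rewrite divr_ge0 ?outer_max_norm_ge0.
have c0 := ltW (net_constant_gt0 R).
have n1 : (1 : R) <= n%:R by rewrite ler1n.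
have n2 : (n%:R : R) <= n%:R ^+ 2 by rewrite expr2 ler_peMr.
have n21 : (1 : R) <= n%:R ^+ 2 by apply: le_trans n2.
have p16 : (9 : R) ^+ n <= 4 ^+ (2 * n).
  by rewrite exprM lerXn2r ?nnegrE//; lra.
have p1 : (1 : R) <= 4 ^+ (2 * n) by rewrite exprn_ege1// ler1n.
pose B : R := n%:R ^+ 2 * 4 ^+ (2 * n).
have B9 : 9 ^+ n <= B.
  by rewrite (le_trans p16)// ler_peMl// (le_trans _ p1).
have Bn : n%:R <= B by rewrite (le_trans n2)// ler_peMr// (le_trans _ n21).
have B0 : 0 <= B by apply: le_trans Bn; rewrite ler0n.
have [est|nest] := pselect (fejer_hermite_estimate g tau n).
  have PL := fejer_hermite_lipschitz n0 gM.
  have Pg t : `|t| <= 1 -> `|(fejer_hermite n g).[t] - g t| <= 2 * tau.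
    by move=> t1; apply: est; rewrite in_itv/= -ler_norml.
  have [KLc err KLk] := KL_approximation PL Pg.
  eexists _, _, _; split; [exact: KLc|exact: err|exact: KLk| |by []].
  have -> : 5 * 9 ^+ n * M * (2 / d%:R) = 10 * (9 ^+ n * (M / d%:R)) by ring.
  rewrite -/B -[B * M / _]mulrA; apply: ler_pM => //; last by rewrite ler_wpM2r.
    by apply: mulr_ge0 => //; rewrite exprn_ge0.
  lra.
have [P [L [L0 Ln PL Pg]]] : exists (P : R -> R) L,
    [/\ 0 <= L, L <= net_constant R * n%:R * M,
        forall x y, `|P x - P y| <= L * `|x - y|
      & forall x, `|x| <= 1 -> `|P x - g x| <= 2 * tau].
  apply: (enough_nodes_lipschitz_approximation n0 delta0 tau_gt0 gM).
    by move=> i x x1; apply: osc; rewrite in_itv/= -ler_norml.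
  by rewrite /M -max_norm_of_unit.
have [KLc err KLk] := KL_approximation (fun s t _ _ => PL s t) Pg.
eexists _, _, _; split; [exact: KLc|exact: err|exact: KLk| |by []].
have dd0 : 0 <= 2 / d%:R :> R by rewrite divr_ge0.
apply: (le_trans (ler_wpM2r dd0 Ln)).
have -> : net_constant R * n%:R * M * (2 / d%:R) =
  2 * net_constant R * (n%:R * (M / d%:R)) by ring.
rewrite -/B -[B * M / _]mulrA; apply: ler_pM; last by rewrite ler_wpM2r.
- by apply: mulr_ge0.
- by apply: mulr_ge0.
- lra.
Qed.

End OuterApproximation.

Theorem theorem4 (R : realType) :
  exists A : R, 0 < A /\
  forall (d : nat) (lambda : 'I_d -> R) (phi : 'I_(2 * d).+1 -> R -> R),
  (2 <= d)%N -> lorentz_system lambda phi ->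
  forall (f : 'rV[R]_d -> R) (eps : R),
  {within @cube R d, continuous f} -> 0 < eps ->
  (exists K, KL_continuous lambda phi K /\
     max_norm (@cube R d) (fun x => f x - K x) <= eps) /\
  forall gf : R -> R, outer_function lambda phi f gf ->
  let g := fun t : R => gf (of_unit d t) in
  let tau := eps / (2 * (2 * d + 1)%:R) in
  (exists N : nat, forall n : nat, (N <= n)%N ->
     enough_nodes g tau n /\ fejer_hermite_estimate g tau n) /\
  (forall n : nat, enough_nodes g tau n ->
     exists (K : 'rV[R]_d -> R) (p : R -> R) (C : R),
       [/\ KL_continuous lambda phi K,
           max_norm (@cube R d) (fun x => f x - K x) <= eps,
           KL_constant lambda phi K p C,
           C <= A * (n%:R ^+ 2 * 4 ^+ (2 * n) *
                     max_norm `[0, d%:R] gf / d%:R)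
         & fejer_hermite_estimate g tau n ->
           forall y, y \in `[0, d%:R] ->
             p y = (fejer_hermite n g).[to_unit d y]]).
Proof.
have c0 := net_constant_gt0 R.
exists (10 + 2 * net_constant R); split; first by lra.
move=> d lambda phi d2 lorentz f eps cf eps0.
have d0 : (0 < d)%N by apply: leq_trans d2.
split; last first.
  move=> gf outer g tau; split; first exact: enough_nodes_large outer.
  by move=> n; exact: KL_approximation_nodes.
have [gf outer] := lorentz_superposition lorentz cf.
have [N /(_ N (leqnn N))[nodes _]] := enough_nodes_large d0 eps0 outer.
have [K [_ [_ [KLc err _ _ _]]]] :=
  KL_approximation_nodes lorentz d0 eps0 outer nodes.
by exists K.
Qed.
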